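(* Let $\{S_n\}_{n=0}^\infty$ be a Type-I or a Type-II elephant random walk with memory parameter $p$ and step sets $\mathcal{U}=\{u_1,\dots,u_m\}$, $\mathcal{W}=\{w_1,\dots,w_{m'}\}\subset\mathbb{R}^d$. Then, for all $p\in(0,1)$, almost surely $$\frac{S_n}{n}\to\frac12(\bar u+\bar w)\quad\text{as } n\to\infty,$$ where $\bar u=\frac1m\sum_{i=1}^m u_i$ and $\bar w=\frac1{m'}\sum_{j=1}^{m'}w_j$.
   Context: Step sets. Fix $d\ge1$, integers $m,m'\ge2$, and finite sets of distinct vectors $\mathcal{U}=\{u_1,\dots,u_m\}\subset\mathbb{R}^d$, $\mathcal{W}=\{w_1,\dots,w_{m'}\}\subset\mathbb{R}^d$. A lattice in $\mathbb{R}^d$ is a discrete additive subgroup spanning $\mathbb{R}^d$ over $\mathbb{R}$. Standing assumptions: - If $\mathcal{U}=\mathcal{W}$ (so $m=m'$): the semigroup $\Gamma=\{\sum_{i=1}^m k_iu_i: k_i\in\mathbb{N}\cup\{0\}\}$ is a lattice in $\mathbb{R}^d$. - If $\mathcal{U}\ne\mathcal{W}$: the semigroup $\Gamma_0=\{\sum_{i=1}^m k_iu_i+\sum_{j=1}^{m'}l_jw_j:\ \sum_i k_i=\sum_j l_j,\ k_i,l_j\in\mathbb{N}\cup\{0\}\}$ is a lattice in $\mathbb{R}^d$, and the sets $\Gamma_0$ and $\Gamma_0+\mathcal{U}$ are disjoint. The state space is $\Gamma=\Gamma_0\sqcup(\Gamma_0+\mathcal{U})$; adding an element of $\mathcal{U}$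 to a point of $\Gamma_0$ gives a point of $\Gamma_0+\mathcal{U}$, and adding an element of $\mathcal{W}$ to a point of $\Gamma_0+\mathcal{U}$ gives a point of $\Gamma_0$. Step processes. Let $p\in(0,1)$ (the memory parameter) and fix $1\le i_0\le m$, $1\le j_0\le m'$. The $\mathcal{U}$-valued sequence $\{\sigma_i\}_{i\ge1}$ is defined by $\sigma_1=u_{i_0}$ and, for each $n\ge1$: given $\sigma_1,\dots,\sigma_n$, let $U_n$ be uniform on $\{1,\dots,n\}$, independent of $\sigma_1,\dots,\sigma_n$; then $\sigma_{n+1}=\sigma_{U_n}$ with probability $p$, and $\sigma_{n+1}=\sigma$ with probability $\frac{1-p}{m-1}$ for each $\sigma\in\mathcal{U}\setminus\{\sigma_{U_n}\}$. The $\mathcal{W}$-valued sequence $\{\tau_j\}_{j\ge1}$ is defined in the same way, with $\tau_1=w_{j_0}$, $m'$ in place of $m$, $\mathcal{W}$ in place of $\mathcal{U}$, and $W_n$ (uniform on $\{1,\dots,n\}$) in place of $U_n$. The two sequences (with their auxiliary variables) are independent of each other. Type-II ERW (case $\mathcal{U}\neq\mathcal{W}$): $S_0=\mathbf{0}$, $S_{2n}=\sum_{i=1}^n(\sigma_i+\tau_i)$ and $S_{2n-1}=S_{2(n-1)}+\sigma_n$ for $n\ge1$. Type-I ERW (case $\mathcal{U}=\mathcal{W}$): $S_0=\mathbf{0}$ and $S_n=\sum_{i=1}^n\sigma_i$ for $n\ge1$. (In this case $m=m'$ and $\bar u=\bar w$.) *)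

(* Defs.v *)
From HB Require Import structures.
From mathcomp Require Import all_boot all_order all_algebra.
From mathcomp Require Import all_classical all_reals all_analysis.

Set Implicit Arguments.
Unset Strict Implicit.
Unset Printing Implicit Defensive.

Import Order.TTheory GRing.Theory Num.Theory.
Import numFieldNormedType.Exports.

Local Open Scope classical_set_scope.
Local Open Scope ring_scope.

Definition is_lattice (R : realType) (d : nat) (L : set 'rV[R]_d) : Prop :=
  [/\ L 0 /\ (forall x y, L x -> L y -> L (x - y)),
      L `<=` isolated L
    & forall v : 'rV[R]_d, exists2 e : seq 'rV[R]_d,
        (forall x, x \in e -> L x) & v \in << e >>%VS].

Definition typeI_semigroup (R : realType) (d m : nat) (u : 'I_m -> 'rV[R]_d) :
    set 'rV[R]_d :=
  [set x | exists k : 'I_m -> nat, x = \sum_(i < m) u i *+ k i].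

Definition typeII_semigroup (R : realType) (d m m' : nat)
    (u : 'I_m -> 'rV[R]_d) (w : 'I_m' -> 'rV[R]_d) : set 'rV[R]_d :=
  [set x | exists (k : 'I_m -> nat) (l : 'I_m' -> nat),
    (\sum_(i < m) k i = \sum_(j < m') l j)%N /\
    x = \sum_(i < m) u i *+ k i + \sum_(j < m') w j *+ l j].

(* The steps and the uniform indices take finitely many values each,
   so the target of each may be given the discrete sigma-algebra: the events
   generated by X are the preimages of arbitrary subsets. *)
Definition rv_events (T V : Type) (X : T -> V) : set (set T) :=
  range (preimage X).

Definition indep (dT : measure_display) (T : measurableType dT) (R : realType)
    (P : probability T R) (G H : set (set T)) : Prop :=
  forall A B, <<s G >> A -> <<s H >> B -> P (A `&` B) = (P A * P B)%E.

(* X and V are indexed from 1, and their values at index 0 are irrelevant.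
   V n is the uniform index used to produce X n.+1. *)
Definition step_process (dT : measure_display) (T : measurableType dT)
    (R : realType) (P : probability T R) (p : R) (d m : nat)
    (u : 'I_m -> 'rV[R]_d) (i0 : 'I_m)
    (X : nat -> T -> 'rV[R]_d) (V : nat -> T -> nat) : Prop :=
  [/\ forall n, (1 <= n)%N ->
        [/\ rv_events (X n) `<=` measurable, rv_events (V n) `<=` measurable,
            forall t, range u (X n t) & forall t, (1 <= V n t <= n)%N],
      forall t, X 1%N t = u i0,
      forall n k, (1 <= k <= n)%N -> P [set t | V n t = k] = (n%:R^-1)%:E,
      forall n, (1 <= n)%N ->
        indep P (rv_events (V n))
                (\bigcup_(i in [set i | 1 <= i <= n]%N) rv_events (X i))
    & forall n k (s : nat -> 'rV[R]_d) v, (1 <= k <= n)%N -> range u v ->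
        let past := [set t | (forall i, (1 <= i <= n)%N -> X i t = s i) /\
                             V n t = k] in
        P (past `&` [set t | X n.+1 t = v]) =
        (P past * (if v == s k then p else (1 - p) / (m%:R - 1))%:E)%E].

Definition process_events (T V W : Type) (X : nat -> T -> V)
    (Y : nat -> T -> W) : set (set T) :=
  \bigcup_(n in [set n | 1 <= n]%N) (rv_events (X n) `|` rv_events (Y n)).

Definition typeI_erw (dT : measure_display) (T : measurableType dT)
    (R : realType) (P : probability T R) (p : R) (d m m' : nat)
    (u : 'I_m -> 'rV[R]_d) (w : 'I_m' -> 'rV[R]_d) (i0 : 'I_m)
    (S : nat -> T -> 'rV[R]_d) : Prop :=
  [/\ range u = range w,
      is_lattice (typeI_semigroup u)
    & exists sigma U,
      [/\ step_process P p u i0 sigma U,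
          forall t, S 0%N t = 0
        & forall n t, (1 <= n)%N -> S n t = \sum_(1 <= i < n.+1) sigma i t]].

Definition typeII_erw (dT : measure_display) (T : measurableType dT)
    (R : realType) (P : probability T R) (p : R) (d m m' : nat)
    (u : 'I_m -> 'rV[R]_d) (w : 'I_m' -> 'rV[R]_d) (i0 : 'I_m) (j0 : 'I_m')
    (S : nat -> T -> 'rV[R]_d) : Prop :=
  [/\ range u <> range w,
      is_lattice (typeII_semigroup u w),
      typeII_semigroup u w `&`
        [set x + y | x in typeII_semigroup u w & y in range u] = set0
    & exists sigma U tau W,
      [/\ step_process P p u i0 sigma U,
          step_process P p w j0 tau W,
          indep P (process_events sigma U) (process_events tau W),
          forall t, S 0%N t = 0
        & forall n t, (1 <= n)%N ->
            S (2 * n)%N t = \sum_(1 <= i < n.+1) (sigma i t + tau i t) /\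
            S (2 * n - 1)%N t = S (2 * (n - 1))%N t + sigma n t]].

Definition mean_step (R : realType) (d m : nat) (u : 'I_m -> 'rV[R]_d) :
    'rV[R]_d :=
  m%:R^-1 *: \sum_(i < m) u i.

(* Main.v *)
Require Import Defs.
From mathcomp Require Import all_boot all_order all_algebra.
From mathcomp Require Import all_classical all_reals all_analysis.
From mathcomp Require Import measurable_realfun ring lra zify.
Import Order.TTheory GRing.Theory Num.Theory.
Import numFieldNormedType.Exports.
Local Open Scope classical_set_scope.
Local Open Scope ring_scope.

Set Implicit Arguments.
Unset Strict Implicit.
Unset Printing Implicit Defensive.

(** Fix one step process and a function [D] on its [m] letters with
    [\sum_j D j = 0], and let [c_n] be the sum of the values of [D] over the
    first [n] steps.  Copying a uniformly chosen past step with probability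
    [p], and otherwise choosing uniformly among the other letters, multiplies
    a centred function by [a = p - (1 - p) / (m - 1)]; so, given the past, the
    next value of [D] has mean [a * c_n / n].  Expanding the square of
    [c_n + D] gives
<<
      E c_(n+1)^2 <= (1 + 2 a / n) E c_n^2 + B,      B a bound on D^2.
>>
    Since [a < 1] for every [p < 1], even in the superdiffusive regime where
    [c_n] is not of order [sqrt n], this recursion makes the series
    [\sum_n E (c_n / n)^2 / n] telescope to a finite bound
    ([moment_sum_bounded]).  Hence [\sum_n (c_n / n)^2 / n] is almost surely
    finite ([ae_bounded_series]).  As consecutive terms of [c_n / n] differ by
    [O(1 / n)], a value of size [e] at time [n] persists at size [e / 2] over
    a block of length proportional to [n], which adds to the series an amount
    depending on [e] only; so [c_n / n] tends to [0]
    ([slowly_varying_cvg0]).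

    Taking for [D] the centred indicators of the letters shows that every
    letter has asymptotic frequency [1 / m], so the average of the steps tends
    to their mean ([step_average_cvg]).  This is the claim for the type I walk,
    whose two step sets have the same mean.  At time [n] the type II walk is a
    sum of [uphalf n] steps of one process and [n./2] steps of the other; each
    of these counts is asymptotic to [n / 2], so each process contributes half
    of its mean step. *)

(** * A Tauberian lemma for slowly varying sequences *)

(** Over a block from [n] to [(1 + r) n], the weights [1 / i] sum to at least
    [r / (1 + r)], whatever [n].  If [`|f n| >= e], then the bound on the
    increments keeps [`|f| >= e / 2] on such a block with [r = e / (2 C)];
    for large [n] this contradicts the Cauchy criterion for the series, which
    converges since it is bounded with nonnegative terms. *)
Lemma slowly_varying_cvg0 (R : realType) (f : nat -> R) (C M : R) :
  0 < C ->
  (forall n, `|f n.+1 - f n| <= C / n.+1%:R) ->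
  (forall n, \sum_(0 <= i < n) f i ^+ 2 / i.+1%:R <= M) ->
  f n @[n --> \oo] --> 0.
Proof.
move=> C0 fC fM.
pose z i := f i ^+ 2 / i.+1%:R.
have z0 i : 0 <= z i by rewrite /z divr_ge0 ?sqr_ge0.
have /cauchy_cvgP /cauchy_seriesP zC : cvgn (series z).
  apply: nondecreasing_is_cvgn.
    apply/nondecreasing_seqP => n.
    by rewrite !seriesEnat /= big_nat_recr//= lerDl.
  by exists M => _ [n _ <-]; exact: fM.
apply/cvgrPdist_lt.
suff near_lt (e : R) : 0 < e -> \forall n \near \oo, `|0 - f n| < e
  by exact: near_lt.
move=> e0.
pose r := e / (2 * C).
have r0 : 0 < r by rewrite divr_gt0 ?mulr_gt0.
have d0 : 0 < e ^+ 2 / 4 * (r / (1 + r)).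
  by rewrite mulr_gt0// divr_gt0 ?exprn_gt0 ?addr_gt0.
have [[A B] /= [[N1 _ N1A] [N2 _ N2B]] AB] := zC _ d0.
exists (maxn N1 N2) => // n; rewrite /= geq_max => /andP[n1 n2].
rewrite sub0r normrN ltNge; apply/negP => en.
have N0 : (0 : R) < n.+1%:R by rewrite ltr0n.
have rn0 : 0 <= r * n.+1%:R by rewrite mulr_ge0 ?ltW.
(* The largest [k] for which the drift bound [k C / (n + 1)] is at most
   [e / 2]. *)
pose K := Num.truncn (r * n.+1%:R).
have [K1 K2] : K%:R <= r * n.+1%:R /\ r * n.+1%:R < K.+1%:R.
  by apply/andP; exact: truncn_itv.
have drift k : `|f (n + k)%N - f n| <= k%:R * (C / n.+1%:R).
  elim: k => [|k IH]; first by rewrite addn0 subrr normr0 mul0r.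
  rewrite addnS -(subrKA (f (n + k)%N)) (le_trans (ler_normD _ _))//.
  rewrite -natr1 mulrDl mul1r addrC lerD//.
  apply: (le_trans (fC _)); rewrite ler_pM2l// lef_pV2 ?posrE ?ltr0n//.
  by rewrite ler_nat ltnS leq_addr.
have big k : (k <= K)%N -> e ^+ 2 / 4 / (n + K).+1%:R <= z (n + k)%N.
  move=> kK.
  have h : e / 2 <= `|f (n + k)%N|.
    have kd : k%:R * (C / n.+1%:R) <= e / 2.
      rewrite mulrA ler_pdivrMr// (@le_trans _ _ (r * n.+1%:R * C))//.
        by rewrite ler_pM2r// (le_trans _ K1)// ler_nat.
      by rewrite /r le_eqVlt; apply/orP; left; apply/eqP; field; rewrite gt_eqF.
    rewrite -(lerD2l (e / 2)) -splitr (le_trans en)//.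
    have := ler_distD (f (n + k)%N) (f n) 0; rewrite !subr0 => /le_trans; apply.
    by rewrite lerD2r distrC (le_trans (drift k)).
  apply: ler_pM; rewrite ?invr_ge0 ?divr_ge0 ?sqr_ge0//.
    rewrite -[f _ ^+ 2]real_normK ?num_real//.
    have -> : e ^+ 2 / 4 = (e / 2) ^+ 2 by field.
    by rewrite lerXn2r ?nnegrE// divr_ge0// ltW.
  by rewrite lef_pV2 ?posrE ?ltr0n// ler_nat ltnS leq_add2l.
have /= := AB (n, n + K.+1)%N
  (conj (N1A _ n1) (N2B _ (leq_trans n2 (leq_addr _ _)))).
rewrite ger0_norm ?sumr_ge0// ltNge => /negP; apply.
have -> : \sum_(n <= k < n + K.+1) z k = \sum_(0 <= k < K.+1) z (n + k)%N.
  rewrite -[X in \sum_(X <= _ < _) _]add0n big_addn addKn.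
  by apply: eq_bigr => k _; rewrite addnC.
apply: (@le_trans _ _ (\sum_(0 <= k < K.+1) e ^+ 2 / 4 / (n + K).+1%:R)); last first.
  rewrite !big_nat; apply: ler_sum => k /andP[_ kK]; exact: big.
rewrite sumr_const_nat subn0 -[leRHS]mulr_natr -[leRHS]mulrA.
rewrite ler_pM2l ?divr_gt0 ?exprn_gt0// [leRHS]mulrC ler_pdivlMr//.
apply/ltW/(le_lt_trans _ K2).
rewrite mulrAC ler_pdivrMr ?addr_gt0// -[leRHS]mulrA ler_pM2l//.
by rewrite -addSn natrD mulrDr mulr1 lerD2l mulrC.
Qed.

(** * Random variables with finite range *)

Lemma integral_finite_range (dT : measure_display) (T : measurableType dT)
    (R : realType) (P : probability T R) (I : finType)
    (F : T -> I) (h : I -> R) :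
  (forall i, measurable (F @^-1` [set i])) ->
  (\int[P]_t (h (F t))%:E =
   (\sum_i h i * fine (P (F @^-1` [set i])))%:E)%E.
Proof.
move=> mF.
have hE t : (h (F t))%:E = (\sum_i (h i)%:E * (\1_(F @^-1` [set i]) t)%:E)%E.
  rewrite (bigD1 (F t))//= indicE mem_set// mule1 big1 ?adde0// => i iF.
  by rewrite indicE memNset ?mule0// => /= Fi; rewrite Fi eqxx in iF.
under eq_integral do rewrite hE.
have int1 i : P.-integrable setT (fun t => (\1_(F @^-1` [set i]) t)%:E).
  by apply: integrable_indic => //.
rewrite integral_sum//; last by move=> i; exact: integrableZl.
rewrite -sumEFin; apply: eq_bigr => i _.
rewrite integralZl// integral_indic// setIT EFinM fineK//.
exact: fin_num_measure.
Qed.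

Lemma measurable_finite_range (dT : measure_display) (T : measurableType dT)
    (R : realType) (I : finType) (F : T -> I) (h : I -> R) :
  (forall i, measurable (F @^-1` [set i])) ->
  measurable_fun setT (h \o F).
Proof.
move=> mF.
have -> : h \o F = fun t => \sum_i h i * \1_(F @^-1` [set i]) t.
  apply/funext => t /=.
  rewrite (bigD1 (F t))//= indicE mem_set// mulr1 big1 ?addr0// => i iF.
  by rewrite indicE memNset ?mulr0// => /= Fi; rewrite Fi eqxx in iF.
apply: measurable_sum => i.
by apply: measurable_funM => //; exact: measurable_indic.
Qed.

(** By monotone convergence the sum of the whole series has a finite integral,
    hence is finite almost everywhere, and it bounds its partial sums. *)
Lemma ae_bounded_series (dT : measure_display) (T : measurableType dT)
    (R : realType) (mu : measure T R) (z : nat -> T -> R) (M : R) :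
  (forall n, measurable_fun setT (z n)) ->
  (forall n t, 0 <= z n t) ->
  (forall n, (\sum_(0 <= i < n) \int[mu]_t (z i t)%:E <= M%:E)%E) ->
  {ae mu, forall t, exists M', forall n, \sum_(0 <= i < n) z i t <= M'}.
Proof.
move=> mz z0 zM.
have mez n : measurable_fun setT (fun t => (z n t)%:E).
  exact/measurable_EFinP.
have ez0 n t : (0 <= (z n t)%:E)%E by rewrite lee_fin.
pose Z t := (\sum_(0 <= n <oo) (z n t)%:E)%E.
have Z0 t : (0 <= Z t)%E by apply: nneseries_ge0.
have intZ : mu.-integrable setT Z.
  apply/integrableP; split; first exact: ge0_emeasurable_sum.
  under eq_integral do rewrite gee0_abs//.
  rewrite integral_nneseries// (@le_lt_trans _ _ M%:E) ?ltry//.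
  apply: lime_le; first by apply: is_cvg_nneseries => n _ _; exact: integral_ge0.
  by apply: nearW => n; exact: zM.
apply: filterS (integrable_ae measurableT intZ) => t /(_ I) Zt.
exists (fine (Z t)) => n.
rewrite -lee_fin fineK// -sumEFin.
by apply: nneseries_lim_ge => i _ _; exact: ez0.
Qed.

(** Values in [R], not in the extended reals, so that expectations over a
    finite range become sums in a ring. *)
Definition law (dT : measure_display) (T : measurableType dT) (R : realType)
    (P : probability T R) (I : Type) (F : T -> I) (i : I) : R :=
  fine (P (F @^-1` [set i])).

Lemma sum_law (dT : measure_display) (T : measurableType dT) (R : realType)
    (P : probability T R) (I : finType) (F : T -> I) :
  (forall i, measurable (F @^-1` [set i])) -> \sum_i law P F i = 1.
Proof.
move=> mF; have := @integral_finite_range _ _ _ P _ F (fun=> 1) mF.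
under [in X in _ = X%:E]eq_bigr do rewrite mul1r.
rewrite integral_cst// mul1e => PT.
by apply: EFin_inj; rewrite -PT; exact: probability_setT.
Qed.

Lemma measurable_pair_fibre (dT : measure_display) (T : measurableType dT)
    (I J : Type) (F : T -> I) (G : T -> J) (k : I * J) :
  (forall i, measurable (F @^-1` [set i])) ->
  (forall j, measurable (G @^-1` [set j])) ->
  measurable ((fun t => (F t, G t)) @^-1` [set k]).
Proof.
move=> mF mG.
have -> : (fun t => (F t, G t)) @^-1` [set k] =
    F @^-1` [set k.1] `&` G @^-1` [set k.2].
  by case: k => a b; apply/seteqP; split => t /= [-> ->].
exact: measurableI.
Qed.

(** Both sides are the integral of the indicator of [F t = i], computed once
    from the law of [F] and once from the joint law. *)
Lemma law_marginal (dT : measure_display) (T : measurableType dT)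
    (R : realType) (P : probability T R) (I J : finType)
    (F : T -> I) (G : T -> J) (i : I) :
  (forall i, measurable (F @^-1` [set i])) ->
  (forall j, measurable (G @^-1` [set j])) ->
  law P F i = \sum_j law P (fun t => (F t, G t)) (i, j).
Proof.
move=> mF mG.
have mFG k := measurable_pair_fibre k mF mG.
have := @integral_finite_range _ _ _ P _ _ (fun k : I * J => (k.1 == i)%:R) mFG.
have -> := @integral_finite_range _ _ _ P _ F (fun k : I => (k == i)%:R) mF.
move=> [].
rewrite (bigD1 i)//= eqxx mul1r big1 ?addr0; last first.
  by move=> k /negbTE ->; rewrite mul0r.
move=> lawE; rewrite {1}/law {}lawE.
transitivity (\sum_k \sum_j (k == i)%:R * law P (fun t => (F t, G t)) (k, j)).
  by rewrite pair_bigA; apply: eq_bigr => -[k j] _.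
rewrite (bigD1 i)//= [X in _ + X]big1 ?addr0; last first.
  by move=> k /negbTE ki; rewrite big1// => j _; rewrite ki mul0r.
by apply: eq_bigr => j _; rewrite eqxx mul1r.
Qed.

(** * Second moments of reinforced sequences *)

Definition path_of (T : Type) (m : nat) (Y : nat -> T -> 'I_m) (n : nat)
    (t : T) : {ffun 'I_n.+1 -> 'I_m} :=
  [ffun k : 'I_n.+1 => Y k t].

(** The measurable structure is arbitrary: instantiated with the sigma-algebra
    generated by the first steps, this says that the past belongs to it. *)
Lemma measurable_path_of (dT : measure_display) (T : measurableType dT)
    (m : nat) (Y : nat -> T -> 'I_m) (n : nat) (s : {ffun 'I_n.+1 -> 'I_m}) :
  (forall k i, (k <= n)%N -> measurable (Y k @^-1` [set i])) ->
  measurable (path_of Y n @^-1` [set s]).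
Proof.
move=> mY.
have -> : path_of Y n @^-1` [set s] =
    \bigcap_(k in [set: 'I_n.+1]) (Y k @^-1` [set s k]).
  apply/seteqP; split => t /= => [<- k _ /=|st]; first by rewrite ffunE.
  by apply/ffunP => k; rewrite ffunE; exact: st.
by apply: fin_bigcap_measurable => // k _; apply: mY; rewrite -ltnS.
Qed.

Definition transition (R : realType) (p : R) (m : nat) (i j : 'I_m) : R :=
  if j == i then p else (1 - p) / (m%:R - 1).

(** The transition matrix is [(p - q) I + q J], with [q = (1 - p) / (m - 1)]
    and [J] the all-ones matrix.  On functions of sum zero it is therefore the
    scalar [p - q]. *)
Lemma sum_transition (R : realType) (p : R) (m : nat) (i : 'I_m)
    (f : 'I_m -> R) :
  \sum_j f j * transition p i j =
  (p - (1 - p) / (m%:R - 1)) * f i + (1 - p) / (m%:R - 1) * \sum_j f j.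
Proof.
rewrite (bigD1 i)//= [X in _ = _ + _ * X](bigD1 i)//= /transition eqxx.
rewrite (eq_bigr (fun j => (1 - p) / (m%:R - 1) * f j)); last first.
  by move=> j /negbTE ->; rewrite mulrC.
by rewrite -mulr_sumr; ring.
Qed.

(** What the copying mechanism says about the letters alone: after averaging
    over the uniform index, the conditional law of the next letter is the mean
    of the transitions from the past letters. *)
Definition reinforced (dT : measure_display) (T : measurableType dT)
    (R : realType) (P : probability T R) (p : R) (m : nat)
    (Y : nat -> T -> 'I_m) : Prop :=
  (forall n i, measurable (Y n @^-1` [set i])) /\
  forall n s j,
    law P (fun t => (path_of Y n t, Y n.+1 t)) (s, j) =
    law P (path_of Y n) s * (n.+1%:R^-1 * \sum_k transition p (s k) j).

(** The sum has [n + 1] terms, for the letters are indexed from 0. *)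
Definition centred_sum (T : Type) (R : realType) (m : nat) (D : 'I_m -> R)
    (Y : nat -> T -> 'I_m) (n : nat) (t : T) : R :=
  \sum_(k < n.+1) D (Y k t).

Definition second_moment (dT : measure_display) (T : measurableType dT)
    (R : realType) (P : probability T R) (f : T -> R) : R :=
  fine (\int[P]_t (f t ^+ 2)%:E).

(** In the expansion of the square, the cross term is governed by the scalar
    [p - q] of [sum_transition], and only the last term is estimated, using
    that the transition probabilities are nonnegative of sum 1. *)
Lemma transition_square_le (R : realType) (p : R) (m : nat) (D : 'I_m -> R)
    (B c : R) (i : 'I_m) :
  0 < p < 1 -> (2 <= m)%N -> \sum_j D j = 0 -> (forall j, D j ^+ 2 <= B) ->
  \sum_j (c + D j) ^+ 2 * transition p i j <=
  c ^+ 2 + 2 * (p - (1 - p) / (m%:R - 1)) * c * D i + B.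
Proof.
move=> /andP[p0 p1] m2 D0 DB.
have m1 : (0 : R) < m%:R - 1 by rewrite subr_gt0 ltr1n.
have q0 j : 0 <= transition p i j.
  rewrite /transition; case: ifP => _; first exact: ltW.
  by rewrite divr_ge0 ?(ltW m1)// subr_ge0 ltW.
have sum1 : \sum_j transition p i j = 1.
  have := sum_transition p i (fun=> 1); under eq_bigr do rewrite mul1r.
  by move=> ->; rewrite sumr_const card_ord; field; rewrite gt_eqF.
have sumD := sum_transition p i D; rewrite D0 mulr0 addr0 in sumD.
have sumB : \sum_j D j ^+ 2 * transition p i j <= B.
  rewrite -[B]mulr1 -sum1 mulr_sumr; apply: ler_sum => j _.
  exact: ler_wpM2r.
have -> : \sum_j (c + D j) ^+ 2 * transition p i j =
    c ^+ 2 * \sum_j transition p i j + 2 * c * \sum_j D j * transition p i j +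
    \sum_j D j ^+ 2 * transition p i j.
  by rewrite !mulr_sumr -!big_split; apply: eq_bigr => j _ /=; ring.
rewrite sum1 sumD; lra.
Qed.

Lemma second_momentE (dT : measure_display) (T : measurableType dT)
    (R : realType) (P : probability T R) (m : nat) (Y : nat -> T -> 'I_m)
    (D : 'I_m -> R) (n : nat) :
  (forall n i, measurable (Y n @^-1` [set i])) ->
  (\int[P]_t (centred_sum D Y n t ^+ 2)%:E =
   (\sum_(s : {ffun 'I_n.+1 -> 'I_m})
      (\sum_k D (s k)) ^+ 2 * law P (path_of Y n) s)%:E)%E.
Proof.
move=> mY.
rewrite -(@integral_finite_range _ _ _ P _ (path_of Y n)
  (fun s : {ffun 'I_n.+1 -> 'I_m} => (\sum_k D (s k)) ^+ 2)); last first.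
  by move=> s; exact: measurable_path_of.
apply: eq_integral => t _; congr (_ ^+ 2)%:E.
by apply: eq_bigr => k _; rewrite ffunE.
Qed.

(** The average over the past of the cross terms [2 a c D (s k)] is
    [2 a c / (n + 1)] times the sum of the [D (s k)], where [a = p - q] as in
    [sum_transition].  This sum is [c] itself, whence the factor
    [1 + 2 a / (n + 1)]. *)
Lemma second_moment_step (dT : measure_display) (T : measurableType dT)
    (R : realType) (P : probability T R) (p : R) (m : nat)
    (Y : nat -> T -> 'I_m) (D : 'I_m -> R) (B : R) (n : nat) :
  0 < p < 1 -> (2 <= m)%N -> reinforced P p Y ->
  \sum_j D j = 0 -> (forall j, D j ^+ 2 <= B) ->
  second_moment P (centred_sum D Y n.+1) <=
  (1 + 2 * (p - (1 - p) / (m%:R - 1)) / n.+1%:R) *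
    second_moment P (centred_sum D Y n) + B.
Proof.
move=> p01 m2 [mY lawY] D0 DB.
have mpath s : measurable (path_of Y n @^-1` [set s]).
  exact: measurable_path_of.
pose c (s : {ffun 'I_n.+1 -> 'I_m}) := \sum_k D (s k).
have mFG k := measurable_pair_fibre k mpath (mY n.+1).
have -> : second_moment P (centred_sum D Y n.+1) =
    \sum_s \sum_j (c s + D j) ^+ 2 *
      law P (fun t => (path_of Y n t, Y n.+1 t)) (s, j).
  rewrite /second_moment.
  rewrite (eq_integral (fun t => ((c (path_of Y n t) + D (Y n.+1 t)) ^+ 2)%:E)).
    rewrite (@integral_finite_range _ _ _ P _ _
      (fun k => (c k.1 + D k.2) ^+ 2) mFG) pair_bigA/=.
    by apply: eq_bigr => -[s j] _.
  move=> t _; rewrite /centred_sum big_ord_recr/=; congr (((_ + _) ^+ 2)%:E).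
  by apply: eq_bigr => k _; rewrite ffunE.
have N0 : n.+1%:R != 0 :> R by rewrite pnatr_eq0.
rewrite /second_moment second_momentE//=.
have -> : B = \sum_s B * law P (path_of Y n) s.
  by rewrite -mulr_sumr sum_law// mulr1.
rewrite mulr_sumr -big_split/=.
apply: ler_sum => s _.
have l0 : 0 <= law P (path_of Y n) s by rewrite fine_ge0.
under eq_bigr do rewrite lawY mulrCA.
rewrite -mulr_sumr [leRHS](_ : _ = law P (path_of Y n) s *
  (n.+1%:R^-1 * \sum_(k < n.+1)
   (c s ^+ 2 + 2 * (p - (1 - p) / (m%:R - 1)) * c s * D (s k) + B))).
  apply: ler_wpM2l => //.
  under eq_bigr do rewrite mulrCA mulr_sumr.
  rewrite -mulr_sumr ler_wpM2l ?invr_ge0// exchange_big/=.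
  by apply: ler_sum => k _; exact: transition_square_le.
rewrite !big_split/= !sumr_const card_ord -mulr_sumr -/(c s).
rewrite -[c s ^+ 2 *+ _]mulr_natr -[B *+ _]mulr_natr.
by field; rewrite nat1r pnatr_eq0/= gt_eqF// subr_gt0 ltr1n.
Qed.

(** * Almost sure convergence of centred averages *)

(** With [N = n + 1], the potential [y = E / N^2 + B / N] is nonnegative, and
    dividing the recursion by [(N + 1)^2] shows that each step lowers it by at
    least [(1 - a) / 2 * E / N^3]; the sum telescopes.  The term [B / N] of
    the potential absorbs the constant [B] of the recursion. *)
Lemma moment_sum_bounded (R : realType) (a B : R) (E : nat -> R) :
  a < 1 -> 0 <= B -> (forall n, 0 <= E n) ->
  (forall n, E n.+1 <= (1 + 2 * a / n.+1%:R) * E n + B) ->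
  forall n, \sum_(0 <= i < n) E i / i.+1%:R ^+ 3 <= 2 / (1 - a) * (E 0%N + B).
Proof.
move=> a1 B0 E0 Erec n.
have a0 : 0 < 1 - a by rewrite subr_gt0.
pose y i := E i / i.+1%:R ^+ 2 + B / i.+1%:R.
have y0 i : 0 <= y i by rewrite addr_ge0 ?divr_ge0 ?exprn_ge0.
have drop i : E i / i.+1%:R ^+ 3 <= 2 / (1 - a) * (y i - y i.+1).
  have := Erec i; have := E0 i; rewrite /y -[i.+2%:R]natr1.
  have : (1 : R) <= i.+1%:R by rewrite ler1n.
  move: i.+1%:R (E i) (E i.+1) => N e e' N1 e0 ee'.
  have N0 : 0 < N by apply: lt_le_trans N1.
  rewrite -ler_pdivrMl ?divr_gt0// invf_div -subr_ge0.
  (* Every summand of the numerator is nonnegative because [1 <= N]. *)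
  have -> : e / N ^+ 2 + B / N - (e' / (N + 1) ^+ 2 + B / (N + 1)) -
      (1 - a) / 2 * (e / N ^+ 3) =
      (((1 - a) * (4 * N ^+ 2 - (N + 1) ^+ 2) + 2 * N) / (2 * N ^+ 3) * e +
       B / N + ((1 + 2 * a / N) * e + B - e')) / (N + 1) ^+ 2.
    by field; rewrite !gt_eqF ?addr_gt0.
  rewrite divr_ge0 ?sqr_ge0// addr_ge0 ?subr_ge0// addr_ge0//; last first.
    by rewrite divr_ge0// ltW.
  rewrite mulr_ge0// divr_ge0 ?mulr_ge0 ?exprn_ge0 ?(ltW N0)//.
  rewrite addr_ge0 ?mulr_ge0 ?(ltW a0) ?(ltW N0)//.
  have -> : 4 * N ^+ 2 - (N + 1) ^+ 2 = (N - 1) * (3 * N + 1) by ring.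
  by rewrite mulr_ge0 ?subr_ge0// addr_ge0 ?mulr_ge0 ?(ltW N0).
apply: (le_trans (ler_sum _ (fun i _ => drop i))).
rewrite -mulr_sumr ler_wpM2l ?divr_ge0 ?(ltW a0)//.
under eq_bigr do rewrite -opprB.
rewrite sumrN telescope_sumr// opprB.
by rewrite lerBlDr [y 0%N]/y expr1n !divr1 lerDl.
Qed.

(** The averages [f n] satisfy both hypotheses of [slowly_varying_cvg0] almost
    surely: the series is bounded because its expectation is, and the
    increment of an average of [n + 1] terms bounded by [C] is at most
    [2 C / (n + 2)]. *)
Lemma centred_average_cvg0 (dT : measure_display) (T : measurableType dT)
    (R : realType) (P : probability T R) (p : R) (m : nat)
    (Y : nat -> T -> 'I_m) (D : 'I_m -> R) :
  0 < p < 1 -> (2 <= m)%N -> reinforced P p Y -> \sum_j D j = 0 ->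
  {ae P, forall t, n.+1%:R^-1 * centred_sum D Y n t @[n --> \oo] --> 0}.
Proof.
move=> p01 m2 rY D0.
have [p0 p1] := andP p01; have [mY _] := rY.
pose a := p - (1 - p) / (m%:R - 1).
have a1 : a < 1.
  apply: (@le_lt_trans _ _ p) => //.
  by rewrite gerBl divr_ge0 ?subr_ge0 ?ler1n ?ltW// ltnW.
pose C := \sum_j `|D j| + 1.
have C0 : 0 < C by rewrite ltr_wpDl ?sumr_ge0.
have DC j : `|D j| <= C.
  by rewrite /C (bigD1 j)//= -addrA lerDl addr_ge0 ?sumr_ge0.
have DB j : D j ^+ 2 <= C ^+ 2.
  by rewrite -real_normK ?num_real// lerXn2r ?nnegrE ?(ltW C0).
pose E n := second_moment P (centred_sum D Y n).
have E0 n : 0 <= E n.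
  by apply: fine_ge0; apply: integral_ge0 => t _; rewrite lee_fin sqr_ge0.
have EB := moment_sum_bounded a1 (sqr_ge0 C) E0
  (fun n => second_moment_step n p01 m2 rY D0 DB).
pose f n t := n.+1%:R^-1 * centred_sum D Y n t.
have intf n : (\int[P]_t (f n t ^+ 2 / n.+1%:R)%:E = (E n / n.+1%:R ^+ 3)%:E)%E.
  rewrite /E /second_moment second_momentE//= mulr_suml.
  under [in RHS]eq_bigr do rewrite mulrAC.
  rewrite -(@integral_finite_range _ _ _ P _ (path_of Y n)
    (fun s : {ffun 'I_n.+1 -> 'I_m} => (\sum_k D (s k)) ^+ 2 / n.+1%:R ^+ 3));
    last by move=> s; exact: measurable_path_of.
  apply: eq_integral => t _; congr (_%:E).
  rewrite /f /centred_sum (eq_bigr (fun k : 'I_n.+1 => D (path_of Y n t k))).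
    by field; rewrite nat1r pnatr_eq0.
  by move=> k _; rewrite ffunE.
have mf n : measurable_fun setT (fun t => f n t ^+ 2 / n.+1%:R).
  rewrite (_ : (fun t => _) =
    (fun s : {ffun 'I_n.+1 -> 'I_m} =>
       (n.+1%:R^-1 * \sum_k D (s k)) ^+ 2 / n.+1%:R) \o path_of Y n).
    by apply: measurable_finite_range => s; exact: measurable_path_of.
  apply/funext => t /=; congr ((_ * _) ^+ 2 / _).
  by apply: eq_bigr => k _; rewrite ffunE.
have := @ae_bounded_series _ _ _ P (fun n t => f n t ^+ 2 / n.+1%:R)
  (2 / (1 - a) * (E 0%N + C ^+ 2)) mf.
move=> /(_ (fun n t => divr_ge0 (sqr_ge0 _) (ler0n _ _))) aeb.
have {aeb} : {ae P, forall t, exists M, forall n,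
    \sum_(0 <= i < n) f i t ^+ 2 / i.+1%:R <= M}.
  apply: aeb => n; under eq_bigr do rewrite intf.
  by rewrite sumEFin lee_fin; exact: EB.
apply: filterS => t [M fM].
apply: (@slowly_varying_cvg0 R (f ^~ t) (2 * C) M) => //; first exact: mulr_gt0.
move=> n.
have sumC : `|centred_sum D Y n t| <= n.+1%:R * C.
  rewrite (le_trans (ler_norm_sum _ _ _))//.
  rewrite (le_trans (ler_sum _ (fun (k : 'I_n.+1) _ => DC (Y k t))))//.
  by rewrite sumr_const card_ord mulr_natl.
have N0 : 0 < n.+1%:R :> R by rewrite ltr0n.
have -> : f n.+1 t - f n t =
    (D (Y n.+1 t) - centred_sum D Y n t / n.+1%:R) / n.+2%:R.
  rewrite /f /centred_sum big_ord_recr/=.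
  by field; rewrite nat1r -natrD !pnatr_eq0.
rewrite normrM ler_pM//; last first.
  by rewrite gtr0_norm ?invr_gt0 ?ltr0n// lef_pV2 ?posrE ?ltr0n// ler_nat.
rewrite (le_trans (ler_normB _ _))// mulr_natl mulr2n lerD//.
by rewrite normrM normfV (gtr0_norm N0) ler_pdivrMr// mulrC.
Qed.

(** * Step processes *)

(** Summing over the value [k] of the uniform index, independence turns the
    probability of a past path together with [k] into [1 / (n + 1)] times
    that of the path, and the defining transition property gives the
    conditional probability of the next letter. *)
Lemma step_process_reinforced (dT : measure_display) (T : measurableType dT)
    (R : realType) (P : probability T R) (p : R) (d m : nat)
    (u : 'I_m -> 'rV[R]_d) (i0 : 'I_m)
    (X : nat -> T -> 'rV[R]_d) (V : nat -> T -> nat) :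
  injective u -> step_process P p u i0 X V ->
  exists Y : nat -> T -> 'I_m,
    (forall n t, X n.+1 t = u (Y n t)) /\ reinforced P p Y.
Proof.
move=> uinj [XV _ Vunif VX XP].
have /choice[Y0 Y0E] : forall nt : nat * T, exists j, X nt.1.+1 nt.2 = u j.
  by move=> [n t]; have [_ _ /(_ t)[j _ <-] _] := XV n.+1 isT; exists j.
pose Y n t := Y0 (n, t).
have YE n t : X n.+1 t = u (Y n t) by exact: (Y0E (n, t)).
have YX n i : Y n @^-1` [set i] = X n.+1 @^-1` [set u i].
  by apply/seteqP; split => t /=; rewrite YE; [move=> ->|exact: uinj].
have mY n i : measurable (Y n @^-1` [set i]).
  by rewrite YX; have [+ _ _ _] := XV n.+1 isT; apply; exists [set u i].
exists Y; split=> //; split=> // n s j.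
have mpath : measurable (path_of Y n @^-1` [set s]).
  exact: measurable_path_of.
pose K t : 'I_n.+1 := inord (V n.+1 t).-1.
have KV k : K @^-1` [set k] = V n.+1 @^-1` [set k.+1].
  have [_ _ _ Vn] := XV n.+1 isT.
  apply/seteqP; split => t /=; have /andP[] := Vn t; rewrite /K.
    case: (V n.+1 t) => [//|v] _ vn <-; rewrite inordK//.
  by move=> _ _ ->; rewrite /= inord_val.
have mV k : measurable (V n.+1 @^-1` [set k]).
  by have [_ + _ _] := XV n.+1 isT; apply; exists [set k].
have mK k : measurable (K @^-1` [set k]) by rewrite KV.
have mF F := @measurable_pair_fibre _ _ _ _ (path_of Y n) (Y n.+1) F
  (fun s => measurable_path_of s (fun k i _ => mY k i)) (mY n.+1).
rewrite (law_marginal P (F := fun t => (path_of Y n t, Y n.+1 t))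
  (s, j) mF mK) !mulr_sumr.
apply: eq_bigr => k _.
(* The steps of the process are indexed from 1, its letters from 0. *)
pose s' i := u (s (inord i.-1)).
pose past := [set t | (forall i, (1 <= i <= n.+1)%N -> X i t = s' i) /\
                      V n.+1 t = k.+1].
have pastE : past = V n.+1 @^-1` [set k.+1] `&` path_of Y n @^-1` [set s].
  apply/seteqP; split => t => [[Xs Vk]|[Vk st]]; split => //=.
    apply/ffunP => i; rewrite ffunE; apply: uinj.
    by rewrite -YE Xs/= ?ltn_ord// /s'/= inord_val.
  case=> [//|i] /= iN; rewrite YE /s' -st ffunE inordK//.
have Ppast : P past = ((n.+1%:R^-1)%:E * P (path_of Y n @^-1` [set s]))%E.
  rewrite pastE (VX n.+1 isT).
  - congr (_ * _)%E; exact: (Vunif n.+1 k.+1 (ltn_ord k)).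
  - by apply: sub_sigma_algebra; exists [set k.+1].
  - set G := \bigcup_(_ in _) _.
    apply: (@measurable_path_of _ (g_sigma_algebraType G) _ Y n s) => i l iN.
    apply: sub_sigma_algebra; exists i.+1 => //=.
    by exists [set u l] => //; rewrite YX.
have := XP n.+1 k.+1 s' (u j) (ltn_ord k).
have ju : range u (u j) by exists j.
move=> /(_ ju) /=; rewrite -/past Ppast => PX.
rewrite {1}/law.
have -> : (fun t => (path_of Y n t, Y n.+1 t, K t)) @^-1` [set (s, j, k)] =
    past `&` [set t | X n.+2 t = u j].
  rewrite pastE -KV.
  have -> : [set t | X n.+2 t = u j] = Y n.+1 @^-1` [set j] by rewrite YX.
  apply/seteqP; split => t /=; first by move=> [-> -> ->].
  by move=> [[-> ->] ->].
have fin_path : P (path_of Y n @^-1` [set s]) \is a fin_num.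
  exact: fin_num_measure.
rewrite PX /law !fineM ?fin_numM//=.
by rewrite /transition /s' (inj_eq uinj)/= inord_val; ring.
Qed.

(** Every step is the sum of the [u j] weighted by the indicators of its
    letter, and [D j] is the centred indicator of the letter [j]. *)
Lemma step_average_cvg (dT : measure_display) (T : measurableType dT)
    (R : realType) (P : probability T R) (p : R) (d m : nat)
    (u : 'I_m -> 'rV[R]_d) (i0 : 'I_m)
    (X : nat -> T -> 'rV[R]_d) (V : nat -> T -> nat) :
  0 < p < 1 -> (2 <= m)%N -> injective u -> step_process P p u i0 X V ->
  {ae P, forall t,
    n%:R^-1 *: (\sum_(1 <= i < n.+1) X i t) @[n --> \oo] --> mean_step u}.
Proof.
move=> p01 m2 uinj /(step_process_reinforced uinj)[Y [XY rY]].
have m0 : m%:R != 0 :> R by rewrite pnatr_eq0; case: m m2 {u i0 uinj Y XY rY}.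
pose D (j i : 'I_m) : R := (i == j)%:R - m%:R^-1.
have D0 j : \sum_i D j i = 0.
  rewrite big_split/= sumr_const card_ord (bigD1 j)//= eqxx big1 ?addr0.
    by rewrite -[_ *+ m]mulr_natr mulNr mulVf// subrr.
  by move=> i /negbTE ->.
have /filter_forall : forall j, {ae P, forall t,
    n.+1%:R^-1 * centred_sum (D j) Y n t @[n --> \oo] --> 0}.
  by move=> j; exact: (centred_average_cvg0 p01 m2 rY (D0 j)).
apply: filterS => t avg0.
rewrite -cvg_shiftS/=.
have -> : (fun n => n.+1%:R^-1 *: \sum_(1 <= i < n.+2) X i t) =
    (fun n => \sum_j
      (n.+1%:R^-1 * centred_sum (D j) Y n t + m%:R^-1) *: u j).
  apply/funext => n.
  have N0 : n.+1%:R != 0 :> R by rewrite pnatr_eq0.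
  rewrite big_add1/= big_mkord.
  transitivity (n.+1%:R^-1 *: \sum_(k < n.+1) \sum_j (Y k t == j)%:R *: u j).
    congr (_ *: _); apply: eq_bigr => k _; rewrite XY (bigD1 (Y k t))//=.
    rewrite eqxx scale1r big1 ?addr0// => j jY.
    by rewrite eq_sym (negbTE jY) scale0r.
  rewrite exchange_big/= scaler_sumr; apply: eq_bigr => j _.
  rewrite -scaler_suml scalerA; congr (_ *: _).
  rewrite /centred_sum /D big_split/= sumr_const card_ord mulrDr.
  by rewrite -[(- _) *+ n.+1]mulr_natl mulrA mulVf// mul1r subrK.
have -> : mean_step u = \sum_j (0 + m%:R^-1) *: u j.
  by rewrite /mean_step scaler_sumr; apply: eq_bigr => j _; rewrite add0r.
apply: cvg_big => [|j _]; first exact: add_continuous.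
by apply: cvgZr_tmp; apply: cvgD; [exact: avg0|exact: cvg_cst].
Qed.

(** * The two walks *)

Lemma mean_step_range (R : realType) (d m m' : nat)
    (u : 'I_m -> 'rV[R]_d) (w : 'I_m' -> 'rV[R]_d) :
  injective u -> injective w -> range u = range w -> mean_step u = mean_step w.
Proof.
move=> uinj winj uw.
have /choice[f fE] : forall i, exists j, w j = u i.
  by move=> i; have [j _ <-] : range w (u i); [rewrite -uw; exists i|exists j].
have /choice[g gE] : forall j, exists i, u i = w j.
  by move=> j; have [i _ <-] : range u (w j); [rewrite uw; exists j|exists i].
have fK : cancel f g by move=> i; apply: uinj; rewrite gE fE.
have gK : cancel g f by move=> j; apply: winj; rewrite fE gE.
have fbij : bijective f by exists g.
have := bij_eq_card fbij; rewrite !card_ord => mm'.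
rewrite /mean_step [in RHS](reindex f)/=; last exact: onW_bij.
congr (_^-1 *: _); first by rewrite mm'.
by apply: eq_bigr => i _; rewrite fE.
Qed.

(** Writes [A (h n) / n] as [(h n / n) * (A (h n) / h n)]; the hypothesis
    [A 0 = 0] covers the times with [h n = 0], where this would divide by
    zero.  The bounds on [h] are satisfied by both [half] and [uphalf]. *)
Lemma cvg_average_half (R : realType) (V : normedModType R) (A : nat -> V)
    (a : V) (h : nat -> nat) :
  A 0%N = 0 -> (forall n, n <= (h n).*2 + 1 /\ (h n).*2 <= n + 1)%N ->
  n%:R^-1 *: A n @[n --> \oo] --> a ->
  n%:R^-1 *: A (h n) @[n --> \oo] --> 2^-1 *: a.
Proof.
move=> A0 hn Aa.
have hoo : h n @[n --> \oo] --> \oo.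
  apply/cvgnyPge => M; exists M.*2.+1 => // n /= Mn.
  by have [+ _] := hn n; rewrite addn1 => /(leq_trans Mn); rewrite ltnS leq_double.
have -> : (fun n => n%:R^-1 *: A (h n)) =
    (fun n => ((h n)%:R / n%:R) *: ((h n)%:R^-1 *: A (h n))).
  apply/funext => n; have [->|h0] := eqVneq (h n) 0%N; first by rewrite A0 !scaler0.
  by rewrite scalerA mulrAC divff ?mul1r// pnatr_eq0.
apply: cvgZ; last exact: (cvg_comp _ _ hoo Aa).
rewrite -cvg_shiftS/=.
apply: (@squeeze_cvgr _ _ _ _ (fun n => 2^-1 - harmonic n)
  (fun n => 2^-1 + harmonic n)).
- apply: nearW => n /=; have [lo hi] := hn n.+1.
  have N0 : 0 < n.+1%:R :> R by rewrite ltr0n.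
  rewrite ler_pdivlMr// ler_pdivrMr// mulrBl mulrDl mulVf ?gt_eqF//.
  move: lo hi; rewrite -(ler_nat R) -[(_.*2 <= _)%N](ler_nat R) !natrD -!muln2.
  by rewrite !natrM => lo hi; apply/andP; split; lra.
- by rewrite -[X in _ --> X]subr0; apply: cvgB; [exact: cvg_cst|exact: cvg_harmonic].
- by rewrite -[X in _ --> X]addr0; apply: cvgD; [exact: cvg_cst|exact: cvg_harmonic].
Qed.

Lemma typeII_partial_sums (R : realType) (d : nat) (T : Type)
    (S sigma tau : nat -> T -> 'rV[R]_d) (t : T) :
  S 0%N t = 0 ->
  (forall n, (1 <= n)%N ->
    S (2 * n)%N t = \sum_(1 <= i < n.+1) (sigma i t + tau i t) /\
    S (2 * n - 1)%N t = S (2 * (n - 1))%N t + sigma n t) ->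
  forall n, S n t = \sum_(1 <= i < (uphalf n).+1) sigma i t +
                    \sum_(1 <= i < n./2.+1) tau i t.
Proof.
move=> S0 Srec n.
have even k : S (2 * k)%N t = \sum_(1 <= i < k.+1) sigma i t +
                              \sum_(1 <= i < k.+1) tau i t.
  case: k => [|k]; first by rewrite muln0 S0 !big_nil addr0.
  by rewrite (Srec k.+1 isT).1 big_split.
rewrite -(odd_double_half n) -mul2n; move: n./2 => k; case: odd.
  have := (Srec k.+1 isT).2; rewrite mulnS add2n !subSS !subn0 => SE.
  rewrite add1n SE even /= mul2n uphalf_double doubleK [in RHS]big_nat_recr//=.
  by rewrite addrAC.
by rewrite add0n even mul2n uphalf_double doubleK.
Qed.

Theorem theorem5p1 (dT : measure_display) (T : measurableType dT)
    (R : realType) (P : probability T R) (p : R) (d m m' : nat)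
    (u : 'I_m -> 'rV[R]_d) (w : 'I_m' -> 'rV[R]_d) (i0 : 'I_m) (j0 : 'I_m')
    (S : nat -> T -> 'rV[R]_d) :
  0 < p < 1 -> (1 <= d)%N -> (2 <= m)%N -> (2 <= m')%N ->
  injective u -> injective w ->
  typeI_erw P p u w i0 S \/ typeII_erw P p u w i0 j0 S ->
  {ae P, forall t, (n%:R^-1 *: S n t) @[n --> \oo] -->
                   2^-1 *: (mean_step u + mean_step w)}.
Proof.
move=> p01 _ m2 m2' uinj winj [[uw _ [sigma [U [su _ SE]]]]|
  [_ _ _ [sigma [U [tau [W [su sw _ S0 Srec]]]]]]].
  rewrite -(mean_step_range uinj winj uw).
  apply: filterS (step_average_cvg p01 m2 uinj su) => t.
  have -> : 2^-1 *: (mean_step u + mean_step u) = mean_step u.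
    by rewrite scalerDr -scalerDl -[2^-1]mul1r -splitr scale1r.
  rewrite -cvg_shiftS => su_cvg; rewrite -cvg_shiftS.
  by under eq_fun do rewrite SE//.
apply: filterS2 (step_average_cvg p01 m2 uinj su)
  (step_average_cvg p01 m2' winj sw) => t ut wt.
have -> : (fun n => n%:R^-1 *: S n t) =
    (fun n => n%:R^-1 *: \sum_(1 <= i < (uphalf n).+1) sigma i t +
              n%:R^-1 *: \sum_(1 <= i < n./2.+1) tau i t).
  apply/funext => n; rewrite -scalerDr.
  by rewrite -(typeII_partial_sums (S0 t) (fun n => Srec n t)).
rewrite scalerDr; apply: cvgD.
- apply: (@cvg_average_half _ _ (fun n => \sum_(1 <= i < n.+1) sigma i t) _ uphalf) ut.
    by rewrite big_nil.
  by move=> n; split; lia.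
- apply: (@cvg_average_half _ _ (fun n => \sum_(1 <= i < n.+1) tau i t) _ half) wt.
    by rewrite big_nil.
  by move=> n; split; lia.
Qed.
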